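(* Let $X$ be a metric space such that $\dim X=0$. If $X$ is non-separable, then $X^\omega$ is h-homogeneous.
   Context: Powers carry the product topology. Here $\dim$ denotes the covering dimension; for a (non-empty) metric space $X$, $\dim X=0$ if and only if every open cover of $X$ has a refinement (again a cover) consisting of pairwise disjoint clopen sets. A subset of a space is clopen if it is closed and open. A space is h-homogeneous if all of its non-empty clopen subsets (with the subspace topology) are homeomorphic to each other. *)

(* Defs.v *)
From HB Require Import structures.
From mathcomp Require Import all_boot all_order all_algebra.
From mathcomp Require Import all_classical all_reals all_analysis.

Set Implicit Arguments.
Unset Strict Implicit.
Unset Printing Implicit Defensive.

Local Open Scope classical_set_scope.

Definition separable (T : topologicalType) :=
  exists2 D : set T, countable D & dense D.

Definition open_cover (T : topologicalType) (U : set (set T)) :=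
  U `<=` open /\ cover U id = [set: T].

Definition refines (T : Type) (V U : set (set T)) :=
  forall B, V B -> exists2 A, U A & B `<=` A.

(* [covering_dim_lt T n] is dim T < n for the Čech-Lebesgue covering dimension:
   every finite open cover has a finite open refinement in which every point
   lies in at most n members.  For n = 0 it says that T is empty, in accordance
   with the convention that the empty space has dimension -1. *)
Definition covering_dim_lt (T : topologicalType) (n : nat) :=
  forall U : set (set T), finite_set U -> open_cover U ->
  exists V : set (set T), [/\ finite_set V, open_cover V, refines V U
    & forall x, ([set B | V B /\ B x] #<= `I_n)%card].

(* dim T = n *)
Definition has_covering_dim (T : topologicalType) (n : nat) :=
  covering_dim_lt T n.+1 /\ ~ covering_dim_lt T n.

Definition homeomorphic (T U : topologicalType) :=
  exists (f : T -> U) (g : U -> T),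
    [/\ continuous f, continuous g, cancel f g & cancel g f].

(* [set_type A] carries the subspace topology, unlike [subspace A]. *)
Definition h_homogeneous (T : topologicalType) :=
  forall A B : set T, clopen A -> clopen B -> A !=set0 -> B !=set0 ->
  homeomorphic (set_type A) (set_type B).

(* Main.v *)
Require Import Defs.
From HB Require Import structures.
From mathcomp Require Import all_boot all_order all_algebra lra.
From mathcomp Require Import all_classical all_reals all_analysis.

(* Write E for the countable power of X.  The main point is that every nonempty
   cylinder box W = {z | forall i, z i in W i} of E is homeomorphic to E, which
   needs only that X is Hausdorff and first countable with clopen base.  The
   homeomorphism is built along a binary tree of pairs of cells, one in E and one
   in the box, by back and forth.  A coordinate i of one side with current domain D
   carries a base point p in D; it is compared with a fresh coordinate j of the
   other side by splitting both cells according to whether the coordinate lies in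
   R = D \ V, where V is a small clopen neighbourhood of p.  If both lie in R,
   then i and j are matched forever: corresponding points agree there.  Otherwise
   the domain of i shrinks to D `&` V, and j receives the base point p and the
   domain ~` R.  Every unmatched coordinate is treated infinitely often, so along
   a branch it either gets matched or is forced to equal its base point; hence each
   branch determines, from a point of one side, exactly one point of the other.

   A nonseparable X with dim X = 0 has a partition into infinitely many nonempty
   clopen sets, so E is a countable sum of clopen copies of itself.  Since a nonempty
   clopen A contains a clopen copy of E, an absorption argument yields that
   A, A + E and E are homeomorphic. *)

Set Implicit Arguments.
Unset Strict Implicit.
Unset Printing Implicit Defensive.
Import Order.TTheory GRing.Theory Num.Theory.

Local Open Scope classical_set_scope.

(** * Gluing homeomorphisms of open sets *)

(* Homeomorphy of the subspaces A and B, meaningful for open A and B only: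
   continuity is required with respect to the neighbourhoods in T. *)
Definition homeo (T : topologicalType) (A B : set T) :=
  exists f g : T -> T,
    (forall x, A x -> [/\ B (f x), g (f x) = x & {for x, continuous f}]) /\
    (forall y, B y -> [/\ A (g y), f (g y) = y & {for y, continuous g}]).

Section Homeo.
Context {T : topologicalType}.
Implicit Types A B C : set T.

Lemma homeo_refl A : homeo A A.
Proof. by exists id, id; split=> x Ax; split => //; exact: cvg_id. Qed.

Lemma homeo_sym A B : homeo A B -> homeo B A.
Proof. by move=> [f [g [fP gP]]]; exists g, f. Qed.

Lemma homeo_trans B A C : homeo A B -> homeo B C -> homeo A C.
Proof.
move=> [f [g [fP gP]]] [h [k [hP kP]]]; exists (h \o f), (g \o k).
split=> [x /fP[Bf gf cf]|x /kP[Bk hk ck]] /=.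
  have [Ch kh ch] := hP _ Bf; rewrite kh; split => //.
  exact: continuous_comp.
have [Ag fg cg] := gP _ Bk; rewrite fg; split => //.
exact: continuous_comp.
Qed.

(** Disjointness makes the choice of an index at a point unambiguous, and openness of the pieces
    makes continuity of the glued maps a local matter. *)
Lemma homeo_bigcup (I : Type) (A B : I -> set T) :
  (forall i, open (A i)) -> (forall i, open (B i)) ->
  (forall i j x, A i x -> A j x -> i = j) ->
  (forall i j x, B i x -> B j x -> i = j) ->
  (forall i, homeo (A i) (B i)) -> homeo (\bigcup_i A i) (\bigcup_i B i).
Proof.
move=> oA oB dA dB /choice[f /choice[g fg]].
pose glue (S : I -> set T) (h : I -> T -> T) x :=
  if pselect (exists i, S i x) is left H then h (projT1 (cid H)) x else x.
have glueE S h i x : (forall i j x, S i x -> S j x -> i = j) -> S i x ->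
    glue S h x = h i x.
  move=> dS Sx; rewrite /glue; case: pselect => [H|[]]; last by exists i.
  by case: cid => j /= Sj; rewrite (dS _ _ _ Sx Sj).
have gluec S h i x : (forall i j x, S i x -> S j x -> i = j) ->
    (forall i, open (S i)) -> S i x -> {for x, continuous (h i)} ->
    {for x, continuous (glue S h)}.
  move=> dS oS Sx ch O; rewrite (glueE _ _ i) // => /ch hO.
  have nS : nbhs x (S i) by apply: open_nbhs_nbhs.
  by apply: filterS2 nS hO => w Sw /=; rewrite (glueE _ _ i).
exists (glue A f), (glue B g).
split=> x [i _ ix]; have [fP gP] := fg i.
  have [Bf gf cf] := fP _ ix; split; last exact: gluec cf.
    by exists i => //; rewrite (glueE _ _ i).
  by rewrite (glueE _ _ i x) // (glueE _ _ i).
have [Ag fg' cg] := gP _ ix; split; last exact: gluec cg.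
  by exists i => //; rewrite (glueE _ _ i).
by rewrite (glueE _ _ i x) // (glueE _ _ i).
Qed.

(** One map [f] serves every [C], so disjoint sets [C] are pulled back to disjoint copies. *)
Lemma homeo_pull A B : open A -> homeo A B ->
  exists f : T -> T, forall C, open C -> C `<=` B ->
    open (A `&` f @^-1` C) /\ homeo (A `&` f @^-1` C) C.
Proof.
move=> oA [f [g [fP gP]]]; exists f => C oC CB; split.
  rewrite openE => x [Ax Cx]; apply: filterI; first exact: open_nbhs_nbhs.
  by have [_ _] := fP _ Ax; apply; exact: open_nbhs_nbhs.
exists f, g; split=> [x [Ax Cx]|x Cx]; first by have [] := fP _ Ax.
by have [Ag fg cg] := gP _ (CB _ Cx); split => //; split => //=; rewrite fg.
Qed.

(** Absorption: the whole space is a countable sum of copies of [A] and of its complement, and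
    shifting the latter by one frees a copy of [A], so it is homeomorphic to [D]. Conversely, the
    copy of the space inside [A] splits into countably many copies, enough to absorb the summands
    [E_ n.+1] of [D]. *)
Lemma homeo_of_split (E_ : nat -> set T) A K :
  (forall n, open (E_ n)) -> (forall n m x, E_ n x -> E_ m x -> n = m) ->
  (forall x, exists n, E_ n x) -> (forall n, homeo (E_ n) [set: T]) ->
  clopen A -> clopen K -> K `<=` A -> homeo K [set: T] ->
  homeo [set: T] A.
Proof.
move=> oE dE cE hE [oA cA] [oK cK] KA hK.
have oAK : open (A `\` K) by rewrite setDE; apply: openI => //; exact: closed_openC.
have oNA : open (~` A) by exact: closed_openC.
have /choice[f] : forall n, exists f : T -> T, forall C, open C ->
    open (E_ n `&` f @^-1` C) /\ homeo (E_ n `&` f @^-1` C) C.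
  move=> n; have [f fP] := homeo_pull (oE n) (hE n).
  by exists f => C oC; exact: fP.
pose P n C := E_ n `&` f n @^-1` C.
move=> f_pull; have fP n C : open C -> open (P n C) /\ homeo (P n C) C.
  exact: f_pull.
have {hK}[h hP] := homeo_pull oK hK.
pose Q n := K `&` h @^-1` E_ n.
have QP n : open (Q n) /\ homeo (Q n) (E_ n) by exact: hP.
have QE n m : homeo (Q n) (E_ m).
  apply: homeo_trans (QP n).2 _; apply: homeo_trans (hE n) _; exact: homeo_sym.
have dQ n m x : Q n x -> Q m x -> n = m by move=> [_ /= ?] [_ /=]; exact: dE.
(* D is a copy of the sum of A and E. *)
pose D := P 0%N A `|` \bigcup_n E_ n.+1.
have hTD : homeo [set: T] D.
  pose S (i : bool * nat) := if i.1 then P i.2 A else P i.2 (~` A).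
  pose S' (i : bool * nat) := if i.1 then P i.2 A else P i.2.+1 (~` A).
  have -> : [set: T] = \bigcup_i S i.
    apply/seteqP; split => // x _; have [n nx] := cE x.
    by have [Ax|Ax] := pselect (A (f n x)); [exists (true, n)|exists (false, n)].
  have -> : D = \bigcup_i S' i.
    apply/seteqP; split => x.
      move=> [[Ex Ax]|[n _ nx]]; first by exists (true, 0%N).
      have [Ax|Ax] := pselect (A (f n.+1 x)); first by exists (true, n.+1).
      by exists (false, n).
    move=> [[[] [|n]] _ [/= Ex Ax]]; first by left.
    - by right; exists n.
    - by right; exists 0%N.
    - by right; exists n.+1.
  apply: homeo_bigcup.
  - by case=> -[] n; exact: (fP _ _ _).1.
  - by case=> -[] n; exact: (fP _ _ _).1.
  - move=> [[] n] [[] m] x [/= Ex Ax] [/= Ex' Ax'];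
    by have e := dE _ _ _ Ex Ex'; subst m.
  - move=> [[] n] [[] m] x [/= Ex Ax] [/= Ex' Ax'];
    have e := dE _ _ _ Ex Ex'; subst => //; by case: e => ->.
  - move=> [[] n] /=; first exact: homeo_refl.
    apply: (@homeo_trans (~` A)); first exact: (fP _ _ _).2.
    by apply: homeo_sym; exact: (fP _ _ _).2.
apply: homeo_trans hTD _; apply: homeo_sym.
(* [None] matches [A] minus [K] with its copy in [P 0%N A]. All other pieces are copies of the whole
   space: in [D], even indices enumerate those inside [P 0%N K] and odd ones the sets [E_ n.+1]. *)
pose S (i : option nat) := if i is Some n then Q n else A `\` K.
pose S' (i : option nat) := if i is Some n then
  if odd n then E_ n./2.+1 else P 0%N (Q n./2) else P 0%N (A `\` K).
have -> : A = \bigcup_i S i.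
  apply/seteqP; split => x.
    move=> Ax; have [Kx|Kx] := pselect (K x); last by exists None.
    by have [n nx] := cE (h x); exists (Some n).
  by move=> [[n|] _ []] // /KA.
have -> : D = \bigcup_i S' i.
  apply/seteqP; split => x.
    move=> [[Ex Ax]|[n _ nx]]; last first.
      by exists (Some n.*2.+1) => //=; rewrite odd_double /= uphalf_double.
    have [Kx|Kx] := pselect (K (f 0%N x)); last by exists None.
    have [n nx] := cE (h (f 0%N x)); exists (Some n.*2) => //=.
    by rewrite odd_double doubleK.
  move=> [[n|] _ /=]; last by move=> [Ex [Ax _]]; left.
  case: ifP => _; first by right; exists n./2.
  by move=> [Ex [Kx _]]; left; split => //; exact: KA.
apply: homeo_bigcup.
- by case=> [n|] //=; exact: (QP n).1.
- case=> [n|] /=; last exact: (fP _ _ _).1.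
  by case: ifP => // _; apply: (fP _ _ _).1; exact: (QP _).1.
- by move=> [n|] [m|] x //= => [/dQ H /H ->//|[Kx _] [_]|[_ Kx] []].
- have half (n m : nat) : odd n = odd m -> n./2 = m./2 -> n = m.
    by move=> e e'; rewrite -(odd_double_half n) e e' odd_double_half.
  move=> [n|] [m|] x //=.
  + case: ifP => on; case: ifP => om.
    * by move=> /dE H /H [] e; congr Some; apply: half; rewrite ?on.
    * by move=> Ex [/(dE _ _ _ Ex)].
    * by move=> [Ex _] /(dE _ _ _ Ex).
    * by move=> [_ /dQ H] [_ /H e]; congr Some; apply: half; rewrite ?on.
  + case: ifP => on; first by move=> Ex [/(dE _ _ _ Ex)].
    by move=> [_ [Kx _]] [_ [_]].
  + case: ifP => on; first by move=> [Ex _] /(dE _ _ _ Ex).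
    by move=> [_ [_ Kx]] [_ []].
- case=> [n|] /=; last by apply: homeo_sym; exact: (fP _ _ _).2.
  case: ifP => _; first exact: QE.
  apply: (homeo_trans (QE n 0%N)); apply: homeo_trans (homeo_sym (QE n./2 0%N)) _.
  by apply: homeo_sym; apply: (fP _ _ _).2; exact: (QP _).1.
Qed.

Lemma homeo_homeomorphic A B : homeo A B -> homeomorphic (set_type A) (set_type B).
Proof.
move=> [f [g [fP gP]]].
have fB (x : set_type A) : f (\val x) \in B.
  by apply/mem_set; have [] := fP _ (set_mem (valP x)).
have gA (y : set_type B) : g (\val y) \in A.
  by apply/mem_set; have [] := gP _ (set_mem (valP y)).
exists (fun x => exist (fun y => y \in B) _ (fB x)).
exists (fun y => exist (fun x => x \in A) _ (gA y)).
split.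
- apply: continuous_comp_initial => x.
  have [_ _ cf] := fP _ (set_mem (valP x)).
  by apply: (@continuous_comp _ _ _ set_val f) => //; exact: initial_continuous.
- apply: continuous_comp_initial => x.
  have [_ _ cg] := gP _ (set_mem (valP x)).
  by apply: (@continuous_comp _ _ _ set_val g) => //; exact: initial_continuous.
- by move=> x; apply/val_inj => /=; have [] := fP _ (set_mem (valP x)).
- by move=> x; apply/val_inj => /=; have [] := gP _ (set_mem (valP x)).
Qed.

End Homeo.

(** * Cylinders in a countable power *)

(** The last component of the decoded triple is dropped, so that each pair recurs; numbers that are
    not codes get a default pair. *)
Definition sched (k : nat) : bool * nat :=
  if (unpickle k : option (bool * nat * nat)) is Some (bi, _) then bi
  else (false, 0%N).

(** Otherwise all the distinct codes of [(bi, m)] would lie below [n], against the pigeonhole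
    principle. *)
Lemma sched_infinitely_often (bi : bool * nat) (n : nat) :
  exists2 k, (n <= k)%N & sched k = bi.
Proof.
apply: contrapT => H.
have lt (m : nat) : (pickle (bi, m) < n)%N.
  rewrite ltnNge; apply/negP => nm; apply: H; exists (pickle (bi, m)) => //.
  by rewrite /sched pickleK.
have: injective (fun m : 'I_n.+1 => Ordinal (lt m)).
  by move=> m m' /(congr1 val)/= /(pcan_inj pickleK)[] /val_inj.
by move/leq_card; rewrite !card_ord ltnn.
Qed.

Definition box (X : Type) (W : nat -> set X) : set (nat -> X) :=
  [set z | forall i, W i (z i)].

Definition cylindric (X : topologicalType) (W : nat -> set X) :=
  (forall i, clopen (W i)) /\ exists m, forall i, (m <= i)%N -> W i = setT.

Section Power.
Context {X : topologicalType}.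
Local Notation E := (prod_topology (fun _ : nat => X)).

Lemma proj_nat_continuous i : continuous ((fun z => z i) : E -> X).
Proof. exact: (@proj_continuous nat (fun=> X) i). Qed.

Lemma cvg_power (F : set_system E) {FF : Filter F} (z : E) :
  (forall i, (fun w : E => w i) @ F --> z i) -> F --> z.
Proof.
move=> H; apply/cvg_sup => i A /= [_ [[C oC <-] Cz CA]].
have /(H i) : nbhs (z i) C by apply: open_nbhs_nbhs.
rewrite nbhs_filterE => FC.
by apply: (@filterS _ F _ ((fun w : E => w i) @^-1` C)) => // w; exact: CA.
Qed.

Lemma box_clopen (W : nat -> set X) : cylindric W -> clopen (box W : set E).
Proof.
move=> [Wc [m Wm]].
have -> : box W = [set z : E | forall i, (i < m)%N -> W i (z i)].
  apply/seteqP; split=> z zW i //.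
  by have [im|mi] := ltnP i m; [exact: zW|rewrite Wm].
elim: {Wm} m => [|m IH].
  by rewrite (_ : mkset _ = setT) //; [exact: (@clopenT E)|apply/seteqP; split].
rewrite (_ : mkset _ = [set z : E | forall i, (i < m)%N -> W i (z i)] `&`
    ((fun z : E => z m) @^-1` (W m))); last first.
  apply/seteqP; split=> [z zW|z [zW Wz] i].
    by split=> [i im|]; apply: zW => //; exact: ltnW.
  by rewrite ltnS leq_eqVlt => /predU1P[->//|]; exact: zW.
apply: clopenI => //; apply: preimage_clopen => //; exact: proj_nat_continuous.
Qed.

End Power.

(** * The back-and-forth tree of pairs of cells *)

Section BackAndForth.
Context {X : topologicalType} (V : nat -> X -> set X).
Context (Xhaus : hausdorff_space X) (Vclopen : forall k p, clopen (V k p)).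
Context (Vcenter : forall k p, V k p p).
Context (Vbase : forall p O, nbhs p O ->
  exists k0, forall k, (k0 <= k)%N -> V k p `<=` O).

(* The booleans index the two sides.  [base s b i] is meaningful only for
   unmatched i; all coordinates from [bound s] on are fresh on both sides. *)
Record state := State {
  partner : bool -> nat -> option nat;
  base : bool -> nat -> X;
  dom : bool -> nat -> set X;
  bound : nat }.

Definition upd {A : Type} (F : bool -> nat -> A) (b : bool) (i : nat) (a : A) :=
  fun b' i' => if (b' == b) && (i' == i) then a else F b' i'.

(** The flag [t] selects the child: true where coordinates [i] and [j] both lie in [R], false where
    neither does. Both children coincide when [i] is already matched. *)
Definition step (k : nat) (t : bool) (s : state) : state :=
  let b := (sched k).1 in let i := (sched k).2 in
  (* The scheduled [i] may itself be fresh, so the new bound has to pass both [i] and [j]. *)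
  let bd := (maxn (bound s) i).+1 in
  let j := bound s in let p := base s b i in
  let R := dom s b i `\` V k p in
  if partner s b i is Some _ then State (partner s) (base s) (dom s) bd
  else if t then
    State (upd (upd (partner s) b i (Some j)) (~~ b) j (Some i)) (base s)
      (upd (upd (dom s) b i R) (~~ b) j R) bd
  else
    State (partner s) (upd (base s) (~~ b) j p)
      (upd (upd (dom s) b i (dom s b i `&` V k p)) (~~ b) j (~` R)) bd.

(** Partners have equal domains, so values can be copied across without leaving the cells. Base
    points are required of unmatched coordinates only: the domain [R] of a matched one misses [p]
    and may be empty. *)
Record wf (s : state) : Prop := Wf {
  wf_fresh : forall b i, (bound s <= i)%N ->
    partner s b i = None /\ dom s b i = setT;
  wf_partner : forall b i j, partner s b i = Some j ->
    partner s (~~ b) j = Some i /\ dom s b i = dom s (~~ b) j;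
  wf_base : forall b i, partner s b i = None -> dom s b i (base s b i);
  wf_clopen : forall b i, clopen (dom s b i) }.

Definition cell (s : state) (b : bool) : set (nat -> X) := box (dom s b).

Lemma upd_neq A (F : bool -> nat -> A) b i a b' i' :
  (b', i') <> (b, i) -> upd F b i a b' i' = F b' i'.
Proof. by rewrite /upd; case: andP => // -[/eqP-> /eqP->]. Qed.

Lemma upd_eq A (F : bool -> nat -> A) b i a : upd F b i a b i = a.
Proof. by rewrite /upd !eqxx. Qed.

Lemma step_wf k t s : wf s -> wf (step k t s).
Proof.
case: s => P B D n [/= Wf Wp Wb Wc]; rewrite /step /=.
case: (sched k) => b i /=.
have bN : forall c : bool, (c == ~~ c) = false by case.
case E : (P b i) => [j|].
  split => //= c d le; apply: Wf; move: le.
  by rewrite gtn_max => /andP[/ltnW].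
have Rc : clopen (D b i `\` V k (B b i)).
  by rewrite setDE; apply: clopenI => //; exact: (clopenC set0).
case: t; split => /=.
- move=> b' i'; rewrite gtn_max => /andP[ni ii].
  rewrite /upd (gtn_eqF ni) (gtn_eqF ii) !andbF; apply: Wf; exact: ltnW.
- move=> b' i' j'; rewrite /upd.
  have [/andP[/eqP -> /eqP ->] [<-]|] := boolP ((b' == ~~ b) && (i' == n)).
    by rewrite negbK bN eqxx /= eqxx.
  move=> N1.
  have [/andP[/eqP -> /eqP ->] [<-]|N2] := boolP ((b' == b) && (i' == i)).
    by rewrite !eqxx /=.
  move=> H; have [H1 H2] := Wp _ _ _ H.
  have -> : (~~ b' == ~~ b) && (j' == n) = false.
    apply/negP => /andP[_ /eqP jn]; move: H1; rewrite jn.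
    by rewrite (Wf _ _ (leqnn n)).1.
  have -> // : (~~ b' == b) && (j' == i) = false.
  by apply/negP => /andP[/eqP bb /eqP ji]; move: H1; rewrite bb ji E.
- move=> b' i'; rewrite /upd; case: ifP => // _; case: ifP => // _; exact: Wb.
- move=> b' i'; rewrite /upd; case: ifP => // _; case: ifP => // _; exact: Wc.
- move=> b' i'; rewrite gtn_max => /andP[ni ii].
  rewrite /upd (gtn_eqF ni) (gtn_eqF ii) !andbF; apply: Wf; exact: ltnW.
- move=> b' i' j' H; have [H1 H2] := Wp _ _ _ H; split=> //.
  rewrite !upd_neq //.
  + by move=> [ee ee']; subst b i; move: E; rewrite H1.
  + by move=> [ee ee']; move: H1; rewrite ee' (Wf _ _ (leqnn n)).1.
  + by move=> [ee ee']; subst b i; move: E; rewrite H.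
  + by move=> [ee ee']; move: H; rewrite ee' (Wf _ _ (leqnn n)).1.
(* In the unmatched child [p] stays admissible on both sides: it lies in [V k p], hence outside
   [R]. *)
- move=> b' i' H; rewrite /upd; case: ifP => [_ [_]|_].
    by apply; exact: Vcenter.
  case: ifP => [/andP[/eqP bb /eqP ii]|_]; last exact: Wb.
  by subst b' i'; split; [exact: Wb|exact: Vcenter].
- move=> b' i'; rewrite /upd; case: ifP => _; first exact: (clopenC set0).
  by case: ifP => // _; apply: clopenI.
Qed.

Lemma step_dom_sub k t s b i : wf s -> dom (step k t s) b i `<=` dom s b i.
Proof.
case: s => P B D n [/= Wf _ _ _]; rewrite /step /=.
case: (sched k) => c j /=; case: (P c j) => [_ x //|]; case: t => /=; rewrite /upd /=.
  case: ifP => [/andP[/eqP-> /eqP->]|_]; first by rewrite (Wf (~~ c) n (leqnn n)).2.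
  by case: ifP => [/andP[/eqP-> /eqP->]|_] // x [].
case: ifP => [/andP[/eqP-> /eqP->]|_]; first by rewrite (Wf (~~ c) n (leqnn n)).2.
by case: ifP => [/andP[/eqP-> /eqP->]|_] // x [].
Qed.

Lemma step_partner k t s b i j : wf s ->
  partner s b i = Some j -> partner (step k t s) b i = Some j.
Proof.
case: s => P B D n [/= Wf _ _ _]; rewrite /step /= => H.
case: (sched k) => c j' /=; case E : (P c j') => [//|]; case: t => //=.
rewrite !upd_neq //.
  by move=> [ee ee']; subst c j'; rewrite H in E.
by move=> [ee ee']; move: H; rewrite ee' (Wf _ _ (leqnn n)).1.
Qed.

(** A step assigns a base point only to the fresh coordinate [bound s]. *)
Lemma step_base k t s b i : (i < bound s)%N ->
  base (step k t s) b i = base s b i.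
Proof.
case: s => P B D n /= ni; rewrite /step /=.
case: (sched k) => c j' /=; case E : (P c j') => [//|]; case: t => //=.
by rewrite upd_neq // => -[_ ee]; subst n; rewrite ltnn in ni.
Qed.

Lemma step_bound k t s : (bound s < bound (step k t s))%N.
Proof.
by rewrite /step; case: (partner _ _ _) => [a|] /=; [|case: t => /=];
  rewrite ltnS leq_maxl.
Qed.

(** A scheduled coordinate that stays unmatched must have gone to the false child. *)
Lemma step_shrink k t s b i : wf s -> sched k = (b, i) ->
  partner (step k t s) b i = None ->
  dom (step k t s) b i `<=` V k (base s b i).
Proof.
case: s => P B D n [/= Wf _ _ _]; rewrite /step /= => -> /=.
case E : (P b i) => [a|] /=; first by rewrite E.
case: t => /=.
  rewrite /upd; case: ifP => // _; by rewrite !eqxx.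
by move=> _; rewrite upd_neq ?upd_eq; [move=> x []|by move=> [] []; case: (b)].
Qed.

Lemma step_cover k s b z : wf s -> cell s b z ->
  exists t, cell (step k t s) b z.
Proof.
case: s => P B D n [/= Wf _ _ _]; rewrite /cell /step /=.
case: (sched k) => c i /=; case E : (P c i) => [a|] /=; first by exists true.
pose R := D c i `\` V k (B c i).
have [<- H|/eqP bc H] := eqVneq c b.
  have [Rz|Rz] := pselect (R (z i)); [exists true|exists false] => i' /=;
   (rewrite upd_neq; last by case; case: (c)); rewrite /upd eqxx /=;
   case: eqP => [->//|_]; try exact: H.
  split; first exact: H.
  by apply: contrapT => ?; apply: Rz; split => //; exact: H.
have cb : b = ~~ c by case: (b) (c) bc => -[].
have [Rz|Rz] := pselect (R (z n)); [exists true|exists false] => i' /=;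
  subst b; rewrite {1}/upd eqxx /=; case: eqP => [->//|_];
  rewrite upd_neq //; exact: H || (by case; case: (c)).
Qed.

(** The conclusion equates states and not flags, because both flags give the same state when the
    scheduled coordinate is matched. *)
Lemma step_disjoint k t t' s b z :
  cell (step k t s) b z -> cell (step k t' s) b z ->
  step k t s = step k t' s.
Proof.
case: s => P B D n; rewrite /cell /step /=.
case: (sched k) => c i /=; case E : (P c i) => [a|] //=.
wlog: t t' / t = true /\ t' = false.
  case: t t' => -[] // W H H'; first exact: (W true false).
  by apply/esym; apply: (W true false).
move=> [-> ->] /=.
have [<-|/eqP bc] := eqVneq c b.
  have ncc A (F : bool -> nat -> A) a : upd F (~~ c) n a c i = F c i.
    by apply: upd_neq; case; case: (c).
  by move=> /(_ i) + /(_ i); rewrite !ncc !upd_eq => -[? ?] [].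
have cb : b = ~~ c by case: (b) (c) bc => -[].
by subst b => /(_ n) + /(_ n); rewrite !upd_eq.
Qed.

(** * Branches of the tree and the correspondence of points *)

Context (s0 : state) (wf0 : wf s0).

Definition branch (sg : nat -> state) :=
  sg 0%N = s0 /\ forall k, exists t, sg k.+1 = step k t (sg k).

Definition follows (sg : nat -> state) b z := forall k, cell (sg k) b z.

Lemma branch_wf sg k : branch sg -> wf (sg k).
Proof.
move=> [sg0 sgS]; elim: k => [|k IH]; first by rewrite sg0.
by have [t ->] := sgS k; exact: step_wf.
Qed.

Lemma branch_bound sg k : branch sg -> (k <= bound (sg k))%N.
Proof.
move=> [sg0 sgS]; elim: k => [//|k IH].
by have [t ->] := sgS k; exact: leq_ltn_trans (step_bound _ _ _).
Qed.

Lemma branch_dom sg k l b i : branch sg -> (k <= l)%N ->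
  dom (sg l) b i `<=` dom (sg k) b i.
Proof.
move=> sgb /subnK <-; elim: (l - k)%N => [//|m IH].
have [t ->] := sgb.2 (m + k)%N.
by apply: subset_trans IH; apply: step_dom_sub; exact: branch_wf.
Qed.

Lemma branch_partner sg k l b i j : branch sg -> (k <= l)%N ->
  partner (sg k) b i = Some j -> partner (sg l) b i = Some j.
Proof.
move=> sgb /subnK <- H; elim: (l - k)%N => [//|m IH].
have [t ->] := sgb.2 (m + k)%N.
by apply: step_partner => //; exact: branch_wf.
Qed.

Lemma branch_partner_inj sg k l b i j j' : branch sg ->
  partner (sg k) b i = Some j -> partner (sg l) b i = Some j' -> j = j'.
Proof.
move=> sgb /(branch_partner sgb (leq_maxl k l)) H.
by move=> /(branch_partner sgb (leq_maxr k l)); rewrite H => -[].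
Qed.

Lemma branch_base sg k b i : branch sg -> (i < k)%N ->
  base (sg k) b i = base (sg i.+1) b i.
Proof.
move=> sgb /subnK <-; elim: (k - i.+1)%N => [//|m <-].
have [t ->] := sgb.2 (m + i.+1)%N.
apply: step_base; apply: (@leq_trans (m + i.+1)); last exact: branch_bound.
by rewrite addnS ltnS leq_addl.
Qed.

Lemma branch_exists b z : cell s0 b z ->
  exists2 sg, branch sg & follows sg b z.
Proof.
move=> z0.
pose next k s := step k (asbool (cell (step k true s) b z)) s.
pose sg := fix F k := if k is k'.+1 then next k' (F k') else s0.
have sgb : branch sg by split => // k; eexists.
exists sg => // ; elim=> [//|k IH] /=; rewrite /next.
have [t Ht] := step_cover k (branch_wf k sgb) IH.
case: (asboolP (cell (step k true (sg k)) b z)) => [//|N].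
by case: t Ht.
Qed.

(** Cells decrease along a branch and distinct siblings are disjoint. Of [sg] only the cell at stage
    [k] is required to contain [z], so that the lemma applies to all points near a given one. *)
Lemma branch_agree sg sg' b z k : branch sg -> branch sg' ->
  cell (sg k) b z -> follows sg' b z -> sg k = sg' k.
Proof.
move=> sgb sgb' + H'; elim: k => [_|k IH H]; first by rewrite sgb.1 sgb'.1.
have {}IH : sg k = sg' k.
  by apply: IH => i; exact: branch_dom (leqnSn k) _ _.
have := H' k.+1; move: H; have [t ->] := sgb.2 k; have [t' ->] := sgb'.2 k.
by rewrite IH; exact: step_disjoint.
Qed.

(** The coordinate is scheduled at arbitrarily late stages [k], each time confining [z i] to [V k p]
    for the same base point [p]; these sets shrink to [p], and [X] is Hausdorff. *)
Lemma follows_base sg b z i : branch sg -> follows sg b z ->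
  (forall k, partner (sg k) b i = None) -> z i = base (sg i.+1) b i.
Proof.
move=> sgb sgz none.
apply: Xhaus => A B nA nB.
exists (z i); split; first exact: nbhs_singleton.
have [k0 k0B] := Vbase nB.
(* Beyond [i.+1] the base point is frozen; beyond [k0] the set [V k] around it lies in [B]. *)
have [k le sk] := sched_infinitely_often (b, i) (maxn i.+1 k0).
move: le; rewrite geq_max => /andP[ik k0k].
apply: (k0B k) => //; rewrite -(branch_base _ _ ik) //.
have [t E] := sgb.2 k; have Z := sgz k.+1 i.
apply: (step_shrink (t := t) (branch_wf k sgb) sk); first by rewrite -E.
by rewrite -E.
Qed.

Definition match_rel b (z z' : nat -> X) := exists sg, [/\ branch sg,
  follows sg b z, follows sg (~~ b) z' &
  forall k i j, partner (sg k) b i = Some j -> z i = z' j].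

Lemma match_rel_sym b z z' : match_rel b z z' -> match_rel (~~ b) z' z.
Proof.
move=> [sg [sgb sgz sgz' H]]; exists sg; split; rewrite ?negbK // => k i j.
move=> /(wf_partner (branch_wf k sgb))[]; rewrite negbK => /H ->//.
Qed.

(** The point [z] determines the branch; then a matched coordinate of the image is copied from [z],
    and one never matched equals its base point. *)
Lemma match_rel_fun b z z1 z2 : match_rel b z z1 -> match_rel b z z2 -> z1 = z2.
Proof.
move=> [sg [sgb sgz sgz1 H1]] [sg' [sgb' sgz' sgz2 H2]].
have E : sg' = sg by apply/funext => k; apply/esym; exact: branch_agree (sgz k) _.
subst sg'; apply/funext => j.
have [[k [i ki]]|none] := pselect (exists k i, partner (sg k) (~~ b) j = Some i).
  have := (wf_partner (branch_wf k sgb) ki).1; rewrite negbK => {}ki.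
  by rewrite -(H1 _ _ _ ki) -(H2 _ _ _ ki).
have {}none k : partner (sg k) (~~ b) j = None.
  by case E : (partner _ _ _) => [i|//]; case: none; exists k, i.
by rewrite (follows_base _ _ none) ?(follows_base _ sgz2 none).
Qed.

Lemma match_rel_exists b z : cell s0 b z -> exists z', match_rel b z z'.
Proof.
move=> /branch_exists[sg sgb sgz].
(* The witness is the value of [z] at the partner if there is one, and otherwise the final base
   point, which [wf_base] keeps in every domain. *)
pose good j x := (forall k i, partner (sg k) (~~ b) j = Some i -> x = z i) /\
  forall k, dom (sg k) (~~ b) j x.
have /choice[z' z'P] : forall j, exists x, good j x.
  move=> j.
  have [[k [i ki]]|none] := pselect (exists k i, partner (sg k) (~~ b) j = Some i).
    exists (z i); split=> [l i' /(branch_partner_inj sgb ki) -> //|l].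
    apply: (branch_dom sgb (leq_maxl l k)).
    have := branch_partner sgb (leq_maxr l k) ki.
    move=> /(wf_partner (branch_wf _ sgb))[_ ->]; rewrite negbK; exact: sgz.
  have {}none k : partner (sg k) (~~ b) j = None.
    by case E : (partner _ _ _) => [i|//]; case: none; exists k, i.
  exists (base (sg j.+1) (~~ b) j); split => k; first by rewrite none.
  apply: (branch_dom sgb (leq_maxl k j.+1)).
  rewrite -(@branch_base sg (maxn k j.+1)) //; last by rewrite leq_max leqnn orbT.
  by apply: wf_base => //; exact: branch_wf.
exists z', sg; split=> // [k j|k i j H]; first exact: (z'P j).2.
have [H' _] := wf_partner (branch_wf k sgb) H.
exact/esym/((z'P j).1 _ _ H').
Qed.

Local Notation E := (prod_topology (fun _ : nat => X)).

Definition partner_point b (z : E) : E := xget z [set z' | match_rel b z z'].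

Lemma partner_pointP b z : cell s0 b z -> match_rel b z (partner_point b z).
Proof.
move=> /match_rel_exists[z' zz'].
exact: (xgetPex z (ex_intro [set z' | match_rel b z z'] z' zz')).
Qed.

Lemma match_rel_cell b z z' : match_rel b z z' -> cell s0 b z /\ cell s0 (~~ b) z'.
Proof. by move=> [sg [[<- _] sgz sgz' _]]; split. Qed.

(** Points in the open cell [sg k] share the branch up to stage [k]. If [j] is matched by then,
    coordinate [j] of the image is a coordinate of the argument; if [j] is never matched, a late
    stage confines it to a small [V k] around the base point. *)
Lemma partner_point_continuous b z : cell s0 b z ->
  {for z, continuous (partner_point b)}.
Proof.
move=> z0; have [sg [sgb sgz sgz' H]] := partner_pointP z0.
have near_cell k : \forall w \near (z : E), cell (sg k) b w.
  have [Wf _ _ Wc] := branch_wf k sgb.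
  have cyl : cylindric (dom (sg k) b).
    by split => //; exists (bound (sg k)) => i /(Wf b)[].
  by apply: open_nbhs_nbhs; split; [exact: (box_clopen cyl).1|exact: sgz].
have key k w : cell (sg k) b w ->
    exists sg', [/\ branch sg', sg k = sg' k, follows sg' (~~ b) (partner_point b w)
     & forall k i j, partner (sg' k) b i = Some j -> w i = partner_point b w j].
  move=> wk; have w0 : cell s0 b w.
    by rewrite -sgb.1 => i; exact: branch_dom (leq0n k) _ (wk i).
  have [sg' [sgb' sgw sgw' H']] := partner_pointP w0.
  by exists sg'; split => //; exact: branch_agree wk sgw.
have FF : Filter (partner_point b w @[w --> (z : E)]).
  exact/fmap_filter/nbhs_filter.
apply: cvg_power => j O nO.
change (\forall w \near (z : E), O (partner_point b w j)).
have [[k [i ki]]|none] := pselect (exists k i, partner (sg k) (~~ b) j = Some i).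
  have := (wf_partner (branch_wf k sgb) ki).1; rewrite negbK => {}ki.
  have nO' : nbhs (z i) O by rewrite (H _ _ _ ki).
  near=> w.
  have /key[sg' [sgb' e _ H']] : cell (sg k) b w by near: w; exact: near_cell.
  rewrite -(H' k i j); last by rewrite -e.
  by near: w; exact: (proj_nat_continuous nO').
have {}none k : partner (sg k) (~~ b) j = None.
  by case e : (partner _ _ _) => [i|//]; case: none; exists k, i.
have [k0 k0O] := Vbase nO.
have [k le sk] := sched_infinitely_often (~~ b, j) (maxn j.+1 k0).
move: le; rewrite geq_max => /andP[jk k0k].
near=> w.
have /key[sg' [sgb' e sgw' _]] : cell (sg k.+1) b w by near: w; exact: near_cell.
apply: (k0O k) => //; rewrite (follows_base _ sgz' none) // -(branch_base _ _ jk) //.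
have [t ek] := sgb.2 k; have := sgw' k.+1 j; rewrite -e ek.
by apply: (step_shrink (branch_wf k sgb) sk); rewrite -ek.
Unshelve. all: by end_near. Qed.

Lemma cell_homeo b : homeo (cell s0 b : set E) (cell s0 (~~ b)).
Proof.
exists (partner_point b), (partner_point (~~ b)).
have aux c x : cell s0 c x -> cell s0 (~~ c) (partner_point c x) /\
    partner_point (~~ c) (partner_point c x) = x.
  move=> cx; have m := partner_pointP cx; have [_ c'] := match_rel_cell m.
  split => //; apply: match_rel_fun (partner_pointP c') _; exact: match_rel_sym.
split=> [x cx|y cy].
  by have [? ?] := aux _ _ cx; split => //; exact: partner_point_continuous.
have [] := aux _ _ cy; rewrite negbK => ? ?; split => //.
exact: partner_point_continuous.
Qed.

End BackAndForth.

(** * Nonempty boxes are copies of the whole power *)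

Section PowerBoxes.
Context {X : topologicalType} (V : nat -> X -> set X).
Context (Xhaus : hausdorff_space X) (Vclopen : forall k p, clopen (V k p)).
Context (Vcenter : forall k p, V k p p).
Context (Vbase : forall p O, nbhs p O ->
  exists k0, forall k, (k0 <= k)%N -> V k p `<=` O).
Local Notation E := (prod_topology (fun _ : nat => X)).

Lemma box_homeo (W : nat -> set X) (q : nat -> X) :
  cylindric W -> box W q -> homeo [set: E] (box W).
Proof.
move=> [Wc [m Wm]] Wq.
(* Nothing is matched yet: side false has the whole power as its cell, side true the box, and the
   coordinates of [q] are base points on both sides. *)
pose s0 := State (fun _ _ => None) (fun _ => q)
  (fun b i => if b then W i else setT) m.
have wf0 : wf s0.
  split => //= [[] i im|[] i _|[] i] //.
  - by rewrite Wm.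
  - exact: (@clopenT X).
have := cell_homeo Xhaus Vclopen Vcenter Vbase wf0 false.
by rewrite /cell /=; have -> : box (fun=> setT) = [set: E] by apply/seteqP; split.
Qed.

(** The boxes around [z] generate a filter that converges to [z] in each coordinate, hence in the
    product. *)
Lemma open_box (A : set E) (z : E) : open A -> A z ->
  exists2 W, cylindric W & box W z /\ box W `<=` A.
Proof.
move=> oA Az.
pose F := filter_from [set W | cylindric W /\ box W z] (fun W => box W : set E).
have FF : Filter F.
  apply: filter_from_filter.
    exists (fun=> setT); split => //; split; first by move=> ?; exact: (@clopenT X).
    by exists 0%N.
  move=> W W' [[Wc [m Wm]] Wz] [[Wc' [m' Wm']] Wz'].
  exists (fun i => W i `&` W' i); last by move=> w Hw; split => i; case: (Hw i).
  split; last by move=> i; split.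
  split; first by move=> i; exact: clopenI.
  exists (maxn m m') => i; rewrite geq_max => /andP[mi mi'].
  by rewrite Wm // Wm' // setTI.
suff /(_ A) : F --> z.
  by case=> [|W [? ?] ?]; [exact: open_nbhs_nbhs|exists W].
apply: cvg_power => i O nO; have [k kO] := Vbase nO.
exists (fun i' => if i' == i then V k (z i) else setT).
  split; last by move=> i' /=; case: eqP => [->|].
  split; first by move=> i'; case: ifP => // _; exact: (@clopenT X).
  by exists i.+1 => i'; case: eqP => // ->; rewrite ltnn.
by move=> w /(_ i) /=; rewrite eqxx; apply: kO.
Qed.

End PowerBoxes.

(** * Zero-dimensional nonseparable metric spaces *)

(** Refine the cover by the interior of [O] and the complement of [p] to order one. The members are
    then pairwise disjoint, hence clopen, and the one containing [p] can only refine the interior of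
    [O]. *)
Lemma covering_dim_lt1_clopen (X : topologicalType) (p : X) (O : set X) :
  accessible_space X -> covering_dim_lt X 1 -> nbhs p O ->
  exists W, [/\ clopen W, W p & W `<=` O].
Proof.
move=> T1 dX nO.
pose U := [set O^°; ~` [set p]].
have [] := dX U.
- by rewrite /U; apply: finite_set2.
- split.
    move=> _ [->|->]; first exact: open_interior.
    exact/closed_openC/accessible_closed_set1.
  apply/seteqP; split=> // x _; have [->|xp] := pselect (x = p).
    by exists O^°; [left|].
  by exists (~` [set p]); [right|].
move=> S [_ [oS cS] SU S1].
have [B SB Bp] : cover S id p by rewrite cS.
have SE C x : S C -> C x -> B x -> C = B.
  move=> SC Cx Bx; have /pcard_leP/injfunPex[f f0 fI] := S1 x.
  apply: fI; rewrite ?inE //.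
  have: (f C < 1)%N by exact: f0.
  have: (f B < 1)%N by exact: f0.
  by rewrite !ltnS !leqn0 => /eqP-> /eqP->.
exists B; split => //; last first.
  have [C [->|->] BC] := SU _ SB; last by case: (BC p Bp).
  by apply: (subset_trans BC); exact: interior_subset.
split; first exact: oS.
have -> : B = ~` (\bigcup_(C in S `\ B) C).
  apply/seteqP; split => x.
    by move=> Bx [C [SC CB] Cx]; apply: CB; exact: SE SC Cx Bx.
  move=> H; have [C SC Cx] : cover S id x by rewrite cS.
  have [<-//|CB] := pselect (C = B).
  by case: H; exists C.
by apply: open_closedC; apply: bigcup_open => C [/oS].
Qed.

(** The union of finite nets of radii [1/(n+1)] is countable and dense. *)
Lemma finite_net_separable (R : realType) (X : metricType R) :
  (forall e : R, (0 < e)%R ->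
    exists s : seq X, forall x, exists2 d, d \in s & ball d e x) ->
  separable X.
Proof.
move=> H.
have /choice[s sP] : forall n, exists s : seq X,
    forall x, exists2 d, d \in s & ball d (n.+1%:R^-1 : R) x.
  by move=> n; apply: H; rewrite invr_gt0.
exists (\bigcup_n [set` s n]).
  by apply: bigcup_countable => // n _; exact/finite_set_countable/finite_seq.
move=> O [x Ox] oO.
have /nbhs_ballP[e /= e0 eO] : nbhs x O by exact: open_nbhs_nbhs.
have [n ne] : exists n, (n.+1%:R^-1 < e)%R.
  have [n _ nP] := near_infty_natSinv_lt (PosNum e0).
  by exists n; exact: nP (leqnn n).
have [d ds dx] := sP n x.
exists d; split; last by exists n.
by apply: eO; apply: ball_sym; exact: le_ball (ltW ne) _ dx.
Qed.

Lemma separated_sequence (R : realType) (X : metricType R) :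
  ~ separable X -> exists2 e : R, (0 < e)%R &
    exists d : nat -> X, forall i j, i != j -> ~ ball (d i) e (d j).
Proof.
move=> nS; apply: contrapT => H; apply: nS; apply: finite_net_separable => e e0.
apply: contrapT => Hs; apply: H; exists e => //.
have /choice[next nextP] : forall s : seq X, exists x,
    forall d, d \in s -> ~ ball d e x.
  move=> s; apply: contrapT => N; apply: Hs; exists s => x.
  by apply: contrapT => N'; apply: N; exists x => d ds dx; apply: N'; exists d.
(* Greedy choice: [pre n] lists the first [n] terms, and [next] avoids the balls around all of
   them. *)
pose pre := fix pre n := if n is m.+1 then next (pre m) :: pre m else [::].
have preP i j : (i < j)%N -> next (pre i) \in pre j.
  elim: j => // j IH; rewrite ltnS leq_eqVlt /= inE => /predU1P[->|/IH ->].
    by rewrite eqxx.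
  by rewrite orbT.
exists (next \o pre) => i j; rewrite neq_ltn => /orP[ij|ji] /=.
  by apply: nextP; exact: preP.
by move=> /ball_sym; apply: nextP; exact: preP.
Qed.

(** Small clopen sets around the points of a separated sequence form a discrete family, so their
    union is clopen and its complement can serve as one more piece. *)
Lemma infinite_clopen_partition (R : realType) (X : metricType R) :
  covering_dim_lt X 1 -> ~ separable X -> exists P : nat -> set X,
    [/\ forall n, clopen (P n), forall n, P n !=set0,
      forall n m x, P n x -> P m x -> n = m & forall x, exists n, P n x].
Proof.
move=> dX /separated_sequence[e e0 [d dP]].
have e4 : (0 < e / 4)%R by rewrite divr_gt0.
(* With radius [e / 4], a ball of that radius meeting [C n] and [C m] joins [d n] to [d m] by four
   steps, within distance [e]; so it meets at most one of the sets. *)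
have /choice[C CP] : forall n, exists W,
    [/\ clopen W, W (d n) & W `<=` ball (d n) (e / 4)%R].
  move=> n; apply: covering_dim_lt1_clopen => //; last exact: nbhsx_ballx.
  exact/hausdorff_accessible/metric_hausdorff.
have close n m x y y' : C n y -> C m y' ->
    ball x (e / 4)%R y -> ball x (e / 4)%R y' -> n = m.
  move=> ny my' xy xy'; apply/eqP; apply: contrapT => /negP nm; apply: (dP _ _ nm).
  have [_ _ /(_ _ ny) ny'] := CP n; have [_ _ /(_ _ my')/ball_sym my] := CP m.
  have := ball_triangle (ball_triangle ny' (ball_sym xy)) (ball_triangle xy' my).
  by apply: le_ball; lra.
have disj n m x : C n x -> C m x -> n = m.
  by move=> nx mx; apply: (close n m x x x) => //; exact: ballxx.
(* The index 0 is left out so that the complement of [U] contains [d 0%N] and is nonempty. *)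
pose U := \bigcup_n C n.+1.
have Uc : clopen U.
  split; first by apply: bigcup_open => n _; have [[]] := CP n.+1.
  rewrite -openC openE => x nUx.
  have nx : nbhs x (ball x (e / 4)%R) by exact: nbhsx_ballx.
  have [[m [y my xy]]|none] :=
      pselect (exists m, exists2 y, C m.+1 y & ball x (e / 4)%R y).
    have nC : nbhs x (~` C m.+1).
      apply: open_nbhs_nbhs; split; last by move=> mx; apply: nUx; exists m.
      by apply: closed_openC; have [[]] := CP m.+1.
    apply: filterS2 nx nC => w xw mw [n _ nw]; apply: mw.
    by rewrite (close _ _ _ _ _ my nw xy xw).
  by apply: filterS nx => w xw [n _ nw]; apply: none; exists n, w.
exists (fun n => if n is m.+1 then C m.+1 else ~` U); split.
- by move=> [|n]; [exact: (clopenC set0)|have [] := CP n.+1].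
- move=> [|n]; last by exists (d n.+1); have [] := CP n.+1.
  exists (d 0%N) => -[n _ nd]; have [_ d0 _] := CP 0%N.
  by have := disj _ _ _ d0 nd.
- move=> [|n] [|m] x //; last exact: disj.
    by move=> Ux mx; case: Ux; exists m.
  by move=> nx Ux; case: Ux; exists n.
- move=> x; have [[n _ nx]|Ux] := pselect (U x); first by exists n.+1.
  by exists 0%N.
Qed.

(** * h-homogeneity of the power *)

Theorem corollary29 (R : realType) (X : metricType R) :
  has_covering_dim X 0 -> ~ separable X ->
  h_homogeneous (prod_topology (fun _ : nat => X)).
Proof.
move=> [dX _] nsX A B cA cB A0 B0; apply: homeo_homeomorphic.
have /choice[V VP] : forall kp : nat * X, exists W,
    [/\ clopen W, W kp.2 & W `<=` ball kp.2 (kp.1.+1%:R^-1 : R)].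
  move=> [k p]; apply: covering_dim_lt1_clopen => //.
    exact/hausdorff_accessible/metric_hausdorff.
  by apply: nbhsx_ballx; rewrite invr_gt0.
pose V' k p := V (k, p).
have Vc k p : clopen (V' k p) by have [] := VP (k, p).
have Vp k p : V' k p p by have [] := VP (k, p).
have Vb p O : nbhs p O -> exists k0, forall k, (k0 <= k)%N -> V' k p `<=` O.
  move=> /nbhs_ballP[e /= e0 eO].
  have [k0 _ k0P] := near_infty_natSinv_lt (PosNum e0).
  exists k0 => k kk x; have [_ _ VO] := VP (k, p).
  by move=> /VO xk; apply: eO; apply: le_ball xk; exact: ltW (k0P _ kk).
have Xh := metric_hausdorff (T := X).
have bh W q := box_homeo Xh Vc Vp Vb (W := W) (q := q).
have [P [Pc P0 Pd Pcov]] := infinite_clopen_partition dX nsX.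
(* Restricting coordinate 0 to [P n] cuts the power into countably many nonempty boxes, each a copy
   of the whole. *)
pose W n := fun i => if i == 0%N then P n else setT.
have Wc n : cylindric (W n).
  split; first by move=> [|i] /=; [exact: Pc|exact: clopenT].
  by exists 1%N => -[].
pose E : topologicalType := prod_topology (fun _ : nat => X).
suff main (C : set E) : clopen C -> C !=set0 -> homeo [set: E] C.
  by apply: homeo_trans (main _ cB B0); apply: homeo_sym; exact: main.
(* A box around [z] inside [C] is the clopen copy of the power that absorption requires. *)
move=> cC [z Cz]; have [K Kc [Kz KC]] := open_box Vc Vp Vb cC.1 Cz.
apply: (@homeo_of_split E (fun n => box (W n)) C (box K)) => //.
- by move=> n; exact: (box_clopen (Wc n)).1.
- by move=> n m x /(_ 0%N) /= + /(_ 0%N) /=; exact: Pd.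
- by move=> x; have [n nx] := Pcov (x 0%N); exists n => -[].
- move=> n; have [p np] := P0 n; apply: homeo_sym; apply: (bh _ (fun=> p)) => //.
  by case.
- exact: box_clopen.
- by apply: homeo_sym; apply: (bh _ z).
Qed.
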